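(* Let $n\ge 0$ be an integer and let $P(z)=\sum_{j=0}^{n}A_j z^j$ be a random polynomial whose coefficients $A_0,A_1,\dots,A_n$ are independent and identically distributed standard normal random variables, $A_j\sim N(0,1)$. Let $\mathbb{E}_{|z|=1,\,P\in\mathcal{P}_n}$ denote the average over the unit circle and over the ensemble $\mathcal{P}_n$ of all such random polynomials. Then: (i) $\mathbb{E}_{|z|=1,\,P\in\mathcal{P}_n}\big[|P(z)|^2\big]=n+1$; (ii) $\mathbb{E}_{|z|=1,\,P\in\mathcal{P}_n}\big[|P(z)|\big]\le\sqrt{n+1}$.
   Context: $\mathcal{P}_n$ denotes the ensemble of random polynomials $P(z)=\sum_{j=0}^n A_j z^j$ with i.i.d. $N(0,1)$ real coefficients, equipped with the probability measure $\mu_P$ given by the joint law of $(A_0,\dots,A_n)$. The unit circle $\{|z|=1\}$ carries its uniform probability measure $\mu_z$, i.e. $z=e^{it}$ with $t$ uniform on $[0,2\pi]$. For a function $F$ of $P$ and $z$, $$\mathbb{E}_{|z|=1,\,P\in\mathcal{P}_n}[F]=\int_{\mathcal{P}_n}\left(\frac{1}{2\pi}\int_0^{2\pi}F(P,e^{it})\,dt\right)d\mu_P .$$ *)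

(* Defs.v *)
From HB Require Import structures.
From mathcomp Require Import all_boot all_order all_algebra.
From mathcomp Require Import all_classical all_reals all_analysis.
From mathcomp Require Import complex.

Set Implicit Arguments.
Unset Strict Implicit.
Unset Printing Implicit Defensive.

Import Order.TTheory GRing.Theory Num.Theory.
Import numFieldNormedType.Exports.

Local Open Scope classical_set_scope.
Local Open Scope ring_scope.

Section random_variables.
Context {d : measure_display} {Omega : measurableType d} {R : realType}.
Context {Pr : probability Omega R} {I : finType}.

(* Mutual independence: the product rule for every subfamily J. *)
Definition mutually_independent (A : I -> {RV Pr >-> R}) : Prop :=
  forall (J : {set I}) (B : I -> set R),
    (forall i, measurable (B i)) ->
    Pr (\bigcap_(i in [set` J]) (A i @^-1` B i)) =
    (\prod_(i in J) Pr (A i @^-1` B i))%E.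

End random_variables.

Section joint_law.
Context {d : measure_display} {Omega : measurableType d} {R : realType}.
Context {Pr : probability Omega R} {m : nat}.
Variable A : 'I_m -> {RV Pr >-> R}.

Definition joint (w : Omega) : m.-tuple R := [tuple A j w | j < m].

Lemma measurable_joint : measurable_fun [set: Omega] joint.
Proof.
apply/measurable_fun_tnthP => i.
rewrite (_ : _ \o _ = A i :> (Omega -> R)); first exact: measurable_funPT.
by apply/funext => w; rewrite /joint /= tnth_mktuple.
Qed.

HB.instance Definition _ :=
  @isMeasurableFun.Build _ _ _ _ joint measurable_joint.

Definition joint_law : probability (m.-tuple R) R := distribution Pr joint.

End joint_law.

Section average.
Context {R : realType}.

Definition expi (t : R) : R[i] := (cos t +i* sin t)%C.

(* Value at a complex point of a polynomial with real coefficients. *)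
Definition ceval (p : {poly R}) (z : R[i]) : R[i] :=
  (map_poly (real_complex R) p).[z].

Definition poly_of_coefs n (a : n.+1.-tuple R) : {poly R} :=
  \sum_(j < n.+1) tnth a j *: 'X^j.

(* Average over the uniform unit circle and over the ensemble of polynomials
   whose coefficient vector has law mu. *)
Definition circle_ensemble_mean n (mu : probability (n.+1.-tuple R) R)
    (F : {poly R} -> R[i] -> R) : \bar R :=
  (\int[mu]_a (((2 * pi)^-1)%R%:E *
     \int[lebesgue_measure]_(t in `[0%R, (2 * pi)%R])
       (F (poly_of_coefs a) (expi t))%:E))%E.

End average.

(* Main.v *)
(** For fixed coefficients [a], orthogonality of the characters on the circle
    (Parseval) turns the mean of [|P|^2] over [|z| = 1] into [\sum_j a_j ^ 2],
    and each [a_j ^ 2] has mean 1 because the standard normal law has variance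
    1.  The second claim follows from the first by integrating the AM-GM bound
    [|P| <= |P|^2 / (2 c) + c / 2] with [c = sqrt (n + 1)]. *)

Require Import Defs.
From HB Require Import structures.
From mathcomp Require Import all_boot all_order all_algebra.
From mathcomp Require Import all_classical all_reals all_analysis.
From mathcomp Require Import complex.
From mathcomp Require Import measurable_realfun.
From mathcomp Require Import ring lra.

Set Implicit Arguments.
Unset Strict Implicit.
Unset Printing Implicit Defensive.

Import Order.TTheory GRing.Theory Num.Theory.
Import numFieldNormedType.Exports.

Local Open Scope classical_set_scope.
Local Open Scope ring_scope.

(** * Integration of nonnegative functions: comparison and densities *)

(* Unlike in [ge0_le_integral], [f] and [g] need not be measurable: this spares
   the joint measurability argument for [a |-> \int_t |P_a(e^{it})|]. *)
Lemma ge0_le_integral_nomeas d (T : measurableType d) (R : realType)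
    (mu : {measure set T -> \bar R}) (D : set T) (f g : T -> \bar R) :
  (forall x, D x -> 0 <= f x)%E -> (forall x, D x -> f x <= g x)%E ->
  (\int[mu]_(x in D) f x <= \int[mu]_(x in D) g x)%E.
Proof.
move=> f0 fg; rewrite !(integral_mkcond D).
have r0 : forall x, (0 <= (f \_ D) x)%E by move=> x; exact: erestrict_ge0.
have rle : forall x, ((f \_ D) x <= (g \_ D) x)%E.
  by move=> x; rewrite lee_restrict.
(* Over the whole space both integrals are suprema over the simple functions lying below the
   integrand, and those below [f] also lie below [g]. *)
rewrite !ge0_integralTE//; last by move=> x; exact: le_trans (r0 x) (rle x).
apply: ereal_sup_le => _ [h hf <-]; exists h => // x.
exact: le_trans (rle x).
Qed.

(** [p] and the Radon-Nikodym derivative of [nu] have the same integral over every measurable set,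
    so they agree almost everywhere, and the change of variables known for the derivative carries
    over to [p]. *)
Lemma ge0_integral_density d (T : measurableType d) (R : realType)
    (nu : {finite_measure set T -> \bar R})
    (mu : {sigma_finite_measure set T -> \bar R})
    (p f : T -> \bar R) :
  nu `<< mu -> measurable_fun [set: T] p ->
  (forall A, measurable A -> nu A = \int[mu]_(x in A) p x)%E ->
  measurable_fun [set: T] f -> (forall x, 0 <= f x)%E ->
  (\int[nu]_x f x = \int[mu]_x (f x * p x))%E.
Proof.
move=> numu mp nuE mf f0.
rewrite -(Radon_Nikodym_SigmaFinite.change_of_variables numu)//.
have iRN := Radon_Nikodym_SigmaFinite.f_integrable numu.
have mRN := measurable_int _ iRN.
apply: ae_eq_integral => //; [exact: emeasurable_funM..|].
apply: ae_eqe_mul2l; apply: integral_ae_eq => // E _ mE.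
by rewrite -nuE// -Radon_Nikodym_SigmaFinite.f_integral.
Qed.

(** * Parseval's identity on the unit circle *)

Lemma sin_natr_2pi (R : realType) (k : nat) : sin (k%:R * (2 * pi)) = 0 :> R.
Proof.
have := periodicn (@sinD2pi R) k 0.
by rewrite sin0 add0r [2 * _]mulr_natl mulr_natl.
Qed.

(** The frequency [j - k] is formed in [R], since subtraction in [nat] would truncate it. *)
Lemma sin_natrB_2pi (R : realType) (j k : nat) :
  sin ((j%:R - k%:R) * (2 * pi)) = 0 :> R.
Proof. by rewrite mulrBl sinB !sin_natr_2pi mul0r mulr0 subrr. Qed.

Lemma expiX (R : realType) (t : R) (k : nat) : expi t ^+ k = expi (k%:R * t).
Proof.
elim: k => [|k IH]; first by rewrite expr0 mul0r /expi cos0 sin0.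
rewrite exprS IH /expi -[k.+1]add1n natrD mulrDl mul1r cosD sinD.
by apply/eqP; rewrite eq_complex /=; apply/andP; split; apply/eqP; ring.
Qed.

Lemma ceval_expi (R : realType) n (a : n.+1.-tuple R) (t : R) :
  ceval (poly_of_coefs a) (expi t) =
  ((\sum_(j < n.+1) tnth a j * cos (j%:R * t)) +i*
   (\sum_(j < n.+1) tnth a j * sin (j%:R * t)))%C.
Proof.
rewrite /ceval /poly_of_coefs rmorph_sum horner_sum.
under eq_bigr => j _.
  rewrite -mul_polyC rmorphM/= map_polyC map_polyXn.
  rewrite hornerM hornerC hornerXn expiX.
  over.
apply/eqP; rewrite eq_complex; apply/andP; split; apply/eqP.
  rewrite (raddf_sum (@complex.Re R)) /=; apply: eq_bigr => j _ /=; ring.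
rewrite (raddf_sum (@complex.Im R)) /=; apply: eq_bigr => j _ /=; ring.
Qed.

(** Expanding the squared real and imaginary parts as double sums, the products of cosines and of
    sines combine by the subtraction formula for the cosine. *)
Lemma sqr_normc_ceval_expi (R : realType) n (a : n.+1.-tuple R) (t : R) :
  Normc.normc (ceval (poly_of_coefs a) (expi t)) ^+ 2 =
  \sum_(j < n.+1) \sum_(k < n.+1)
     tnth a j * tnth a k * cos ((j%:R - k%:R) * t).
Proof.
rewrite ceval_expi /= sqr_sqrtr ?addr_ge0 ?sqr_ge0//.
rewrite !expr2 !big_distrlr/= -big_split/=; apply: eq_bigr => j _.
rewrite -big_split/=; apply: eq_bigr => k _.
by rewrite mulrBl cosB; ring.
Qed.

Lemma continuous_cosM (R : realType) (m : R) :
  continuous (fun t => cos (m * t)).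
Proof.
move=> t; apply: (continuous_comp (f := fun t => m * t) (g := @cos R)).
  exact: mulrl_continuous.
exact: continuous_cos.
Qed.

(** The hypothesis encodes that [m] is a frequency fitting the circle: for nonzero [m] it makes the
    antiderivative [sin (m * t) / m] vanish at both ends. *)
Lemma integral_cosM_2pi (R : realType) (m : R) : sin (m * (2 * pi)) = 0 ->
  (\int[lebesgue_measure]_(t in `[0%R, (2 * pi)%R]) (cos (m * t))%:E =
   (if m == 0 then 2 * pi else 0)%:E)%E.
Proof.
move=> sinm; have pi2_gt0 : 0 < 2 * pi :> R by rewrite mulr_gt0 ?pi_gt0.
have [->|m0] := eqVneq m 0.
  under eq_integral do rewrite mul0r cos0.
  by rewrite integral_cst//= mul1e lebesgue_measure_itv/= lte_fin pi2_gt0 sube0.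
pose F t := m^-1 * sin (m * t).
have dF (t : R) : is_derive t 1 F (cos (m * t)).
  have dl : is_derive t 1 (fun t => m * t) m.
    by apply: is_derive_eq; rewrite scaler1.
  have dF := is_deriveZ m^-1 (is_derive1_comp (is_derive_sin (m * t)) dl).
  apply: (is_derive_eq dF).
  by rewrite [_ *: _]mulrC mulfK.
rewrite (@continuous_FTC2 _ _ F)//.
- by rewrite /F sinm mulr0 mulr0 sin0 mulr0 subee.
- exact/continuous_subspaceT/continuous_cosM.
- have cF : continuous F.
    by move=> t; apply/differentiable_continuous/derivable1_diffP.
  split.
  + by move=> t _; exact: ex_derive.
  + exact/cvg_at_right_filter/cF.
  + exact/cvg_at_left_filter/cF.
- by move=> t _; rewrite derive1E; exact: derive_val.
Qed.

Lemma integrable_cosM (R : realType) (c m : R) :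
  lebesgue_measure.-integrable `[0, 2 * pi] (fun t : R => (c * cos (m * t))%:E).
Proof.
apply: continuous_compact_integrable; first exact: segment_compact.
apply: continuous_subspaceT => t.
by apply: cvgM; [exact: cvg_cst|exact: continuous_cosM].
Qed.

Lemma integrable_sqr_ceval (R : realType) n (a : n.+1.-tuple R) :
  lebesgue_measure.-integrable `[0, 2 * pi]
    (fun t => (Normc.normc (ceval (poly_of_coefs a) (expi t)) ^+ 2)%:E).
Proof.
rewrite (_ : (fun _ => _) = fun t : R => (\sum_(j < n.+1) \sum_(k < n.+1)
    (tnth a j * tnth a k * cos ((j%:R - k%:R) * t))%:E)%E); last first.
  apply/funext => t; rewrite sqr_normc_ceval_expi -sumEFin.
  by apply: eq_bigr => j _; rewrite sumEFin.
by do 2 apply: integrable_sum => // ? _; exact: integrable_cosM.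
Qed.

(** Orthogonality: in the double sum only the diagonal terms [k = j] have a nonzero frequency
    integral, equal to [2 * pi]. *)
Lemma integral_sqr_ceval (R : realType) n (a : n.+1.-tuple R) :
  (\int[lebesgue_measure]_(t in `[0%R, (2 * pi)%R])
     (Normc.normc (ceval (poly_of_coefs a) (expi t)) ^+ 2)%:E =
   (2 * pi * \sum_(j < n.+1) tnth a j ^+ 2)%:E)%E.
Proof.
transitivity (\int[lebesgue_measure]_(t in `[0%R, (2 * pi)%R])
    \sum_(j < n.+1) \sum_(k < n.+1)
      (tnth a j * tnth a k * cos ((j%:R - k%:R) * t))%:E)%E.
  apply: eq_integral => t _; rewrite sqr_normc_ceval_expi -sumEFin.
  by apply: eq_bigr => j _; rewrite sumEFin.
rewrite integral_sum//=; last first.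
  by move=> j; apply: integrable_sum => // k _; exact: integrable_cosM.
rewrite mulr_sumr -sumEFin; apply: eq_bigr => j _.
rewrite integral_sum//=; last by move=> k; exact: integrable_cosM.
rewrite (bigD1 j)//= big1 ?addr0 => [|k kj].
  under eq_integral do rewrite EFinM.
  rewrite integralZl//=; last first.
    by apply: eq_integrable (integrable_cosM 1 _) => // t _; rewrite mul1r.
  by rewrite integral_cosM_2pi ?sin_natrB_2pi// subrr eqxx -EFinM mulrC expr2.
under eq_integral do rewrite EFinM.
rewrite integralZl//=; last first.
  by apply: eq_integrable (integrable_cosM 1 _) => // t _; rewrite mul1r.
rewrite integral_cosM_2pi ?sin_natrB_2pi// subr_eq0 eqr_nat.
by rewrite eq_sym (inj_eq val_inj) (negbTE kj) mule0.
Qed.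

(** * The second moment of the standard normal density *)

Section normal_variance.
Variable R : realType.
Local Notation mu := (@lebesgue_measure R).
Local Notation phi := (normal_pdf (0 : R) 1).

Lemma normal_pdf01E x : phi x = normal_peak 1 * expR (- x ^+ 2 / 2).
Proof. by rewrite normal_pdfE ?oner_neq0// /normal_fun subr0 expr1n. Qed.

Lemma normal_pdf01N x : phi (- x) = phi x.
Proof. by rewrite !normal_pdf01E sqrrN. Qed.

Lemma continuous_sqr_normal_pdf01 : continuous (fun x : R => x ^+ 2 * phi x).
Proof.
move=> x; apply: cvgM; first exact: exprn_continuous.
exact/continuous_normal_pdf/oner_neq0.
Qed.

(** Since [phi' = - x * phi], the function [x * phi x] is the boundary term of the integration by
    parts that trades [x ^+ 2 * phi x] for [phi x]. *)
Lemma is_derive_id_normal_pdf01 (x : R) :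
  is_derive x 1 (fun x : R => x * phi x) (phi x - x ^+ 2 * phi x).
Proof.
have -> : (fun x : R => x * phi x) =
    (fun x : R => x * (normal_peak 1 * expR (- x ^+ 2 / 2))).
  by apply/funext => y; rewrite normal_pdf01E.
have dq : is_derive x 1 (fun x : R => - x ^+ 2 / 2) (- x).
  by apply: is_derive_eq; rewrite !scaler0 add0r /GRing.scale/=; field.
have de := is_deriveZ (normal_peak 1)
  (@is_derive1_comp R expR (fun y => - y ^+ 2 / 2) x _ _ (is_derive_expR _) dq).
apply: (is_derive_eq (is_deriveM (is_derive_id x 1) de)).
by rewrite normal_pdf01E /= /GRing.scale/=; ring.
Qed.

Lemma integral_sqr_normal_pdf01_itv (b : R) : 0 < b ->
  (\int[mu]_(x in `[0%R, b]) (x ^+ 2 * phi x)%:E =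
   \int[mu]_(x in `[0%R, b]) (phi x)%:E - (b * phi b)%:E)%E.
Proof.
move=> b0.
have cphi : continuous phi := @continuous_normal_pdf R 0 1 (oner_neq0 R).
have icont (f : R -> R) : continuous f -> mu.-integrable `[0, b] (EFin \o f).
  move=> cf; apply: continuous_compact_integrable; first exact: segment_compact.
  exact: continuous_subspaceT.
have := @continuous_FTC2 R (fun x => phi x - x ^+ 2 * phi x)
  (fun x => x * phi x) 0 b b0.
have dF x := is_derive_id_normal_pdf01 x.
have cF : continuous (fun x : R => x * phi x).
  by move=> x; apply/differentiable_continuous/derivable1_diffP.
rewrite mul0r sube0 => <-.
- under [X in (_ = _ - X)%E]eq_integral do rewrite EFinB.
  rewrite integralB//=; [|exact: icont|]; last first.
    exact: (icont _ continuous_sqr_normal_pdf01).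
  (* Finiteness of both integrals is what permits the cancellation [u - (u - v) = v] in the extended
     reals. *)
  have finI f : continuous f ->
      (\int[mu]_(x in `[0%R, b]) (f x)%:E)%E \is a fin_num.
    by move=> cf; apply: integrable_fin_num => //; exact: icont.
  have f1 := finI _ cphi; have f2 := finI _ continuous_sqr_normal_pdf01.
  by rewrite -(fineK f1) -(fineK f2) -!EFinB subKr.
- apply: continuous_subspaceT => x.
  by apply: cvgB; [exact: cphi|exact: continuous_sqr_normal_pdf01].
- split.
  + by move=> x _; exact: ex_derive.
  + exact/cvg_at_right_filter/cF.
  + exact/cvg_at_left_filter/cF.
- by move=> x _; rewrite derive1E; exact: derive_val.
Qed.

(** This is the boundary term at infinity, squeezed between 0 and a multiple of the harmonic
    sequence. *)
Lemma cvg_id_normal_pdf01 : n.+1%:R * phi n.+1%:R @[n --> \oo] --> (0 : R).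
Proof.
have c0 := normal_peak_ge0 (1 : R).
apply: (@squeeze_cvgr _ _ _ _ (fun=> 0)
    (fun n => 2 * normal_peak 1 * harmonic n)).
- near=> n; rewrite mulr_ge0 ?normal_pdf_ge0//=.
  have n0 : (0 : R) < n.+1%:R by rewrite ltr0n.
  (* With [x = n.+1%:R] the claim amounts to [x ^+ 2 <= 2 * expR (x ^+ 2 / 2)], which follows from
     [1 + y <= expR y] at [y = x ^+ 2 / 2]. *)
  have decay : n.+1%:R * expR (- n.+1%:R ^+ 2 / 2) <= 2 / n.+1%:R :> R.
    rewrite mulNr expRN ler_pdivrMr ?expR_gt0// mulrAC ler_pdivlMr//.
    have := expR_ge1Dx (n.+1%:R ^+ 2 / 2 : R); nra.
  by rewrite normal_pdf01E mulrCA [2 * _]mulrC -mulrA ler_wpM2l.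
- exact: cvg_cst.
- rewrite -[0](mulr0 (2 * normal_peak 1)).
  by apply: cvgM; [exact: cvg_cst|exact: cvg_harmonic].
Unshelve. all: by end_near. Qed.

Lemma integral0y_normal_pdf01 :
  (\int[mu]_(x in `[0%R, +oo[) (phi x)%:E = (2^-1)%:E)%E.
Proof.
have := @integral_normal_pdf R 0 1.
rewrite ge0_symfun_integralT; last 3 first.
- by move=> x; exact: normal_pdf_ge0.
- exact: continuous_normal_pdf (oner_neq0 R).
- by move=> x; rewrite /= normal_pdf01N.
rewrite -set_itvcy.
(* Symmetry has reduced total mass 1 to twice the half-line integral; an infinite value of that
   integral would contradict this equation. *)
case: integral => [r| |].
- by rewrite -EFinM => -[e]; congr EFin; lra.
- by rewrite gt0_muley// lte_fin.
- by rewrite gt0_muleNy// lte_fin.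
Qed.

(** Integration by parts on [[0, n + 1]] is passed to the limit: the mass tends to one half, the
    boundary term to 0, and monotone convergence identifies the left-hand side. *)
Lemma integral0y_sqr_normal_pdf01 :
  (\int[mu]_(x in `[0%R, +oo[) (x ^+ 2 * phi x)%:E = (2^-1)%:E)%E.
Proof.
have mphi : measurable_fun [set: R] phi := measurable_normal_pdf 0 1.
have lphi := @ge0_cvgn_integral R mu phi (normal_pdf_ge0 0 1) mphi.
(* The endpoint [n.+1] is positive for every [n], as the formula on [[0, b]] demands; [cvg_shiftS]
   relates it to the endpoint [n] of monotone convergence. *)
have lsqr : (\int[mu]_(x in `[0%R, n.+1%:R]) (x ^+ 2 * phi x)%:E)%E
    @[n --> \oo] --> (2^-1 : R)%:E.
  rewrite integral0y_normal_pdf01 -cvg_shiftS in lphi.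
  rewrite (_ : (fun n => _) = fun n =>
    (\int[mu]_(x in `[0%R, n.+1%:R]) (phi x)%:E
     - (n.+1%:R * phi n.+1%:R)%:E)%E); last first.
    by apply/funext => n; rewrite integral_sqr_normal_pdf01_itv.
  have -> : (2^-1)%:E = ((2^-1)%:E - 0)%E :> \bar R by rewrite sube0.
  apply: cvgeB => //.
  by apply: cvg_EFin; [exact: nearW|exact: cvg_id_normal_pdf01].
have := @ge0_cvgn_integral R mu (fun x => x ^+ 2 * phi x).
move=> /(_ _ _)/cvg_lim <-//.
- by apply/cvg_lim => //; rewrite -cvg_shiftS.
- by move=> x; rewrite mulr_ge0 ?sqr_ge0 ?normal_pdf_ge0.
- by apply: measurable_funM => //; exact: measurable_funX.
Qed.

Lemma integral_sqr_normal_pdf01 : (\int[mu]_x (x ^+ 2 * phi x)%:E = 1)%E.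
Proof.
rewrite ge0_symfun_integralT.
- by rewrite -set_itvcy integral0y_sqr_normal_pdf01 -EFinM divff.
- by move=> x; rewrite mulr_ge0 ?sqr_ge0 ?normal_pdf_ge0.
- exact: continuous_sqr_normal_pdf01.
- by move=> x; rewrite /= sqrrN normal_pdf01N.
Qed.

End normal_variance.

(** * Moments of the random coefficients *)

Lemma second_moment_normal01 (R : realType) (d : measure_display)
    (Omega : measurableType d) (Pr : probability Omega R) (X : {RV Pr >-> R}) :
  (forall B : set R, measurable B -> distribution Pr X B = normal_prob 0 1 B) ->
  (\int[Pr]_w (X w ^+ 2)%:E = 1)%E.
Proof.
move=> Xnormal.
(* [normal_prob] is a measure on [measurableTypeR R], whose display differs from
   that of [R]; pushing [Pr] forward to this type makes the two comparable. *)
have msqr : measurable_fun [set: measurableTypeR R]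
    (fun x : measurableTypeR R => ((x : R) ^+ 2)%:E).
  by apply/measurable_EFinP; exact: measurable_funX.
have mX : measurable_fun [set: Omega] (X : Omega -> measurableTypeR R).
  exact: (measurable_funPT X).
have := @ge0_integral_pushforward _ _ _ _ R _ mX Pr setT _ measurableT msqr.
rewrite preimage_setT => <-; last by move=> x _; rewrite lee_fin sqr_ge0.
transitivity (\int[normal_prob (0 : R) 1]_x (x ^+ 2)%:E)%E.
  by apply: eq_measure_integral => B mB _; exact: Xnormal.
rewrite (@ge0_integral_density _ _ _ (normal_prob 0 1) lebesgue_measure
  (EFin \o normal_pdf 0 1))//.
- by rewrite -[RHS](integral_sqr_normal_pdf01 R); apply: eq_integral => x _.
- exact: normal_prob_dominates.
- by apply/measurable_EFinP; exact: measurable_normal_pdf.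
- by move=> x; rewrite lee_fin sqr_ge0.
Qed.

(** Pulled back to [Omega], the integral splits by linearity into [n] second moments, each equal to
    1. *)
Lemma integral_joint_law_sum_sqr (R : realType) (d : measure_display)
    (Omega : measurableType d) (Pr : probability Omega R) (n : nat)
    (A : 'I_n -> {RV Pr >-> R}) :
  (forall j, \int[Pr]_w (A j w ^+ 2)%:E = 1)%E ->
  (\int[joint_law A]_a (\sum_(j < n) tnth a j ^+ 2)%:E = n%:R%:E)%E.
Proof.
move=> A2.
rewrite ge0_integral_distribution/=; first last.
- by move=> a; rewrite lee_fin sumr_ge0// => j _; exact: sqr_ge0.
- apply/measurable_EFinP; apply: measurable_sum => j.
  by apply: measurable_funX; exact: measurable_tnth.
under eq_integral => w _ do
  [rewrite /= -sumEFin; under eq_bigr do rewrite tnth_mktuple].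
rewrite ge0_integral_sum//=.
- by rewrite (eq_bigr _ (fun j _ => A2 j)) sumEFin sumr_const card_ord.
- by move=> j; apply/measurable_EFinP; apply: measurable_funX.
- by move=> j w _; rewrite lee_fin sqr_ge0.
Qed.

(** * Circle averages and ensemble averages *)

Lemma mean_sqr_ceval (R : realType) n (a : n.+1.-tuple R) :
  (((2 * pi)^-1)%:E * \int[lebesgue_measure]_(t in `[0%R, (2 * pi)%R])
     (Normc.normc (ceval (poly_of_coefs a) (expi t)) ^+ 2)%:E =
   (\sum_(j < n.+1) tnth a j ^+ 2)%:E)%E.
Proof.
rewrite integral_sqr_ceval -EFinM mulKf//.
by rewrite mulf_neq0// gt_eqF ?pi_gt0.
Qed.

Lemma mean_normc_ceval_le (R : realType) n (a : n.+1.-tuple R) (c : R) : 0 < c ->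
  (((2 * pi)^-1)%:E * \int[lebesgue_measure]_(t in `[0%R, (2 * pi)%R])
     (Normc.normc (ceval (poly_of_coefs a) (expi t)))%:E <=
   ((2 * c)^-1 * (\sum_(j < n.+1) tnth a j ^+ 2) + c / 2)%:E)%E.
Proof.
move=> c0; have pi2_gt0 : 0 < 2 * pi :> R by rewrite mulr_gt0 ?pi_gt0.
(* The bound is rewritten as [(2 * pi)^-1] times [2 * pi] times itself, so that the normalising
   factor cancels on both sides. *)
rewrite -[((2 * c)^-1 * _ + _)%R](mulKf (lt0r_neq0 pi2_gt0)) [leRHS]EFinM.
rewrite lee_pmul2l ?lte_fin ?invr_gt0//.
set r := fun t : R => Normc.normc (ceval (poly_of_coefs a) (expi t)).
have amgm t : r t <= (2 * c)^-1 * r t ^+ 2 + c / 2.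
  (* The gap in the AM-GM bound is the square [(r t - c) ^+ 2] over [2 * c]. *)
  have -> : (2 * c)^-1 * r t ^+ 2 + c / 2 = r t + (2 * c)^-1 * (r t - c) ^+ 2.
    by field; rewrite lt0r_neq0.
  by rewrite lerDl mulr_ge0 ?sqr_ge0// invr_ge0 mulr_ge0 ?ltW.
apply: (@le_trans _ _ (\int[lebesgue_measure]_(t in `[0%R, (2 * pi)%R])
    (((2 * c)^-1)%:E * (r t ^+ 2)%:E + (c / 2)%:E))%E).
  apply: ge0_le_integral_nomeas => t _; last by rewrite lee_fin; exact: amgm.
  by rewrite lee_fin /r ceval_expi sqrtr_ge0.
have ir := integrable_sqr_ceval a.
have icst : lebesgue_measure.-integrable `[0, 2 * pi]
    (fun=> (c / 2)%:E : \bar R).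
  apply: continuous_compact_integrable; first exact: segment_compact.
  by apply: continuous_subspaceT => t; exact: cvg_cst.
rewrite integralD//=; last exact: integrableZl.
rewrite integralZl// integral_sqr_ceval integral_cst//= lebesgue_measure_itv/=.
rewrite lte_fin pi2_gt0 sube0 -!EFinM -EFinD lee_fin.
suff -> : (2 * c)^-1 * (2 * pi * \sum_(j < n.+1) tnth a j ^+ 2)
      + c / 2 * (2 * pi) =
    2 * pi * ((2 * c)^-1 * \sum_(j < n.+1) tnth a j ^+ 2 + c / 2) by [].
ring.
Qed.

Lemma circle_ensemble_mean_sqr (R : realType) n
    (mu : probability (n.+1.-tuple R) R) :
  circle_ensemble_mean mu (fun P z => Normc.normc (ceval P z) ^+ 2) =
  (\int[mu]_a (\sum_(j < n.+1) tnth a j ^+ 2)%:E)%E.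
Proof. by apply: eq_integral => a _; exact: mean_sqr_ceval. Qed.

(** The bound for fixed coefficients is integrated over the ensemble; the constant [c / 2] survives
    unchanged because [mu] has total mass 1. *)
Lemma circle_ensemble_mean_normc_le (R : realType) n
    (mu : probability (n.+1.-tuple R) R) (c : R) : 0 < c ->
  (circle_ensemble_mean mu (fun P z => Normc.normc (ceval P z)) <=
   ((2 * c)^-1)%:E *
     (\int[mu]_a (\sum_(j < n.+1) tnth a j ^+ 2)%:E) + (c / 2)%:E)%E.
Proof.
move=> c0.
have msum : measurable_fun [set: n.+1.-tuple R]
    (fun a : n.+1.-tuple R => (\sum_(j < n.+1) tnth a j ^+ 2)%:E).
  apply/measurable_EFinP; apply: measurable_sum => j.
  by apply: measurable_funX; exact: measurable_tnth.
have sum0 (a : n.+1.-tuple R) : (0 <= (\sum_(j < n.+1) tnth a j ^+ 2)%:E)%E.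
  by rewrite lee_fin sumr_ge0// => j _; exact: sqr_ge0.
have c20 : (0 <= ((2 * c)^-1)%:E)%E by rewrite lee_fin invr_ge0 mulr_ge0 ?ltW.
apply: (@le_trans _ _ (\int[mu]_a (((2 * c)^-1)%:E *
    (\sum_(j < n.+1) tnth a j ^+ 2)%:E + (c / 2)%:E))%E).
  apply: ge0_le_integral_nomeas => a _; last exact: mean_normc_ceval_le.
  rewrite mule_ge0 ?lee_fin ?invr_ge0 ?mulr_ge0 ?pi_ge0//.
  by apply: integral_ge0 => t _; rewrite lee_fin ceval_expi sqrtr_ge0.
rewrite ge0_integralD//=.
- rewrite ge0_integralZl// integral_cst//=.
  by rewrite probability_setT mule1.
- by move=> a _; rewrite mule_ge0.
- exact: measurable_funeM.
- by move=> a _; rewrite lee_fin divr_ge0 ?ltW.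
Qed.

Theorem theorem3p1 (R : realType) (d : measure_display)
    (Omega : measurableType d) (Pr : probability Omega R) (n : nat)
    (A : 'I_n.+1 -> {RV Pr >-> R})
    (A_indep : mutually_independent A)
    (A_normal : forall (j : 'I_n.+1) (B : set R), measurable B ->
       distribution Pr (A j) B = normal_prob 0 1 B) :
  circle_ensemble_mean (joint_law A) (fun P z => Normc.normc (ceval P z) ^+ 2)
    = (n.+1%:R)%:E /\
  (circle_ensemble_mean (joint_law A) (fun P z => Normc.normc (ceval P z))
    <= (Num.sqrt n.+1%:R)%:E)%E.
Proof.
have E2 := integral_joint_law_sum_sqr
  (fun j => second_moment_normal01 (A_normal j)).
split; first by rewrite circle_ensemble_mean_sqr E2.
have c0 : 0 < Num.sqrt n.+1%:R :> R by rewrite sqrtr_gt0 ltr0n.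
apply: (le_trans (circle_ensemble_mean_normc_le (joint_law A) c0)).
(* Writing [n + 1] as [c ^+ 2] with [c = sqrt (n + 1)] makes the bound [c ^+ 2 / (2 * c) + c / 2],
   which is exactly [c]. *)
rewrite E2 -EFinM -EFinD lee_fin -[X in _ * X + _](@sqr_sqrtr R) ?ler0n//.
rewrite le_eqVlt; apply/orP; left; apply/eqP; field.
exact: lt0r_neq0.
Qed.
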